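(* Let $X$ be a Cantor set, let $G$ be a finitely generated group, and let $(X,G,\Phi,\mu)$ be a locally quasi-analytic minimal equicontinuous action, where $\mu$ is its unique invariant probability measure. Then the following is true. (1) There exists a subgroup $H \subset G$ such that the set of points $x\in X$ whose stabilizer $G_x$ is conjugate to $H$ in $G$ is residual in $X$. (2) In addition, suppose $(X,G,\Phi,\mu)$ is locally non-degenerate. Then the set of points $x\in X$ whose stabilizer $G_x$ is conjugate to $H$ in $G$ has full $\mu$-measure in $X$.
   Context: Actions. An action $(X,G,\Phi)$ is a homomorphism $\Phi:G\to \mathrm{Homeo}(X)$, with $g\cdot x=\Phi(g)(x)$. It is minimal if every orbit $G(x)=\{g\cdot x\mid g\in G\}$ is dense in $X$. It is equicontinuous if $X$ admits a compatible metric $d$ such that for all $\epsilon>0$ there is $\delta>0$ such that $d(x,y)<\delta$ implies $d(g\cdot x,g\cdot y)<\epsilon$ for all $g\in G$. A minimal equicontinuous action is uniquely ergodic, and $\mu$ denotes its unique invariant Borel probability measure. The stabilizer of $x$ is $G_x=\{g\in G\mid g\cdot x=x\}$. A subset is residual if it contains a dense $G_\delta$ set. Locally quasi-analytic (LQA). Let $D$ be a metric on $X$ compatible with its topology. The action $(X,G,\Phi)$ is LQA if there exists $\epsilon>0$ such that for any open set $U\subset X$ with $\mathrm{diam}(U)<\epsilon$, any non-empty open subset $V\subset U$ and any $g_1,g_2\in G$: if $\Phi(g_1)|V=\Phi(g_2)|V$ then $\Phi(g_1)|U=\Phi(g_2)|U$. Trees. A rooted spherically homogeneous tree $T$ with spherical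 index $(n_1,n_2,\ldots)$, where each $n_\ell\ge 2$ is an integer, has vertex set $V=\bigsqcup_{\ell\ge0}V_\ell$ with $|V_0|=1$; every vertex of $V_{\ell-1}$ is joined by edges to exactly $n_\ell$ vertices of $V_\ell$, and every vertex of $V_{\ell}$ is joined to exactly one vertex of $V_{\ell-1}$ ($\ell\ge 1$). The boundary $\partial T$ is the Cantor set of infinite paths $(v_\ell)_{\ell\ge0}$, $v_\ell\in V_\ell$, with consecutive vertices joined by an edge (topology induced from $\prod_\ell V_\ell$). For $v\in V$, $\partial T_v\subset\partial T$ is the clopen set of paths through $v$. The counting measure $\mu_{\partial T}$ is the Borel probability measure with $\mu_{\partial T}(\partial T_v)=1/(n_1\cdots n_\ell)$ for $v\in V_\ell$. Every $g\in \mathrm{Aut}(T)$ (root- and level-preserving automorphisms) induces a homeomorphism of $\partial T$. Locally non-degenerate. The action of $g\in \mathrm{Aut}(T)$ on $\partial T$ is locally non-degenerate if there exists $0<\alpha_g\le1$ such that for any vertex $v\in V$, if $g$ fixes $v$ and $g|\partial T_v\neq \mathrm{id}$, then $\mu_{\partial T}(\{\mathbf w\in\partial T_v\mid g\cdot\mathbf w\ne\mathbf w\})\ge \alpha_g\,\mu_{\partial T}(\partial T_v)$. The action of a subgroup of $\mathrm{Aut}(T)$ on $\partial T$ is locally non-degenerate if the action of each of its elements is. A minimal equicontinuous action $(X,G,\Phi,\mu)$ is locally non-degenerate if there exist a rooted spherically homogeneous tree $T$ and a homeomorphism $\phi:X\to\partial T$ such that for every $g\in G$ the map $\phi\circ\Phi(g)\circ\phi^{-1}$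 is induced by an automorphism of $T$, and the resulting action of the group $\{\phi\circ\Phi(g)\circ\phi^{-1}\mid g\in G\}$ on $\partial T$ is locally non-degenerate. (Under such $\phi$, $\mu$ is pushed forward to $\mu_{\partial T}$.) *)

(* Defs.v *)
From HB Require Import structures.
From mathcomp Require Import all_boot all_order all_algebra.
From mathcomp Require Import all_classical all_reals all_analysis.
From mathcomp Require Import borel_hierarchy.

Set Implicit Arguments.
Unset Strict Implicit.
Unset Printing Implicit Defensive.

Import Order.TTheory GRing.Theory Num.Theory.
Import numFieldNormedType.Exports.

Local Open Scope classical_set_scope.
Local Open Scope ring_scope.

Section groups.
Context {G : groupType}.

Definition is_subgroup (H : set G) := group_closed [in H].

Definition finitely_generated :=
  exists s : seq G,
    forall H : set G, is_subgroup H -> [set` s] `<=` H -> H = [set: G].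

Definition conjugate_subgroups (H K : set G) :=
  exists g : G, K = [set conjg h g | h in H].

End groups.
Arguments finitely_generated : clear implicits.

Section topology.

Definition homeomorphism {X Y : topologicalType} (f : X -> Y) :=
  continuous f /\
  exists f' : Y -> X, [/\ continuous f', cancel f f' & cancel f' f].

Definition residual {X : topologicalType} (S : set X) :=
  exists B : set X, [/\ Gdelta B, dense B & B `<=` S].

Definition compatible_metric {R : realType} {X : topologicalType}
    (d : X -> X -> R) :=
  [/\ forall x y, 0 <= d x y,
      forall x y, d x y = 0 <-> x = y,
      forall x y, d x y = d y x,
      forall x y z, d x z <= d x y + d y z &
      forall U : set X, open U <->
        (forall x, U x -> exists2 e : R, 0 < e & [set y | d x y < e] `<=` U)].

Definition diameter {R : realType} {X : Type} (d : X -> X -> R) (U : set X)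
    : \bar R :=
  ereal_sup [set (d p.1 p.2)%:E | p in U `*` U].

End topology.

Definition borel (X : ptopologicalType) := g_sigma_algebraType (@open X).

Section actions.
Context {G : groupType} {X : ptopologicalType} (Phi : G -> X -> X).

Definition is_action :=
  [/\ forall g, homeomorphism (Phi g),
      forall x, Phi 1%g x = x &
      forall g h x, Phi (g * h)%g x = Phi g (Phi h x)].

Definition orbit (x : X) : set X := [set Phi g x | g in [set: G]].

Definition stabilizer (x : X) : set G := [set g | Phi g x = x].

Definition minimal := forall x, dense (orbit x).

Definition equicontinuous_action (R : realType) :=
  exists2 d : X -> X -> R, compatible_metric d &
    forall e : R, 0 < e -> exists2 delta : R, 0 < delta &
      forall x y, d x y < delta -> forall g, d (Phi g x) (Phi g y) < e.

Definition invariant_measure (R : realType)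
    (mu : {measure set (borel X) -> \bar R}) :=
  forall g (A : set (borel X)), measurable A -> mu (Phi g @^-1` A) = mu A.

Definition locally_quasi_analytic (R : realType) (D : X -> X -> R) :=
  exists2 e : R, 0 < e &
    forall U : set X, open U -> (diameter D U < e%:E)%E ->
    forall V : set X, open V -> V !=set0 -> V `<=` U ->
    forall g1 g2 : G,
      (forall x, V x -> Phi g1 x = Phi g2 x) ->
      (forall x, U x -> Phi g1 x = Phi g2 x).

End actions.

(* Only edges between consecutive levels exist, so the edge relation is given
   level by level.  The spherical index is shifted: [tree_index l] is
   n_(l+1), the number of vertices of level l+1 adjacent to a vertex of
   level l. *)
Record sph_tree := SphTree {
  tree_index : nat -> nat;
  level : nat -> finType;
  adj : forall l, level l -> level l.+1 -> bool;
  tree_index_ge2 : forall l, (2 <= tree_index l)%N;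
  card_level0 : #|level 0%N| = 1%N;
  card_children : forall l (v : level l),
    #|[pred w : level l.+1 | adj v w]| = tree_index l;
  card_parents : forall l (w : level l.+1),
    #|[pred v : level l | adj v w]| = 1%N
}.

Section boundary.
Variable T : sph_tree.

Definition paths : set (prod_topology (fun l => discrete_topology (level T l)))
  := [set w | forall l, @adj T l (w l) (w l.+1)].

(* The topology is the one induced from the product of the discrete levels. *)
Definition boundary : Type := set_type paths.

HB.instance Definition _ := Topological.on boundary.

Definition to_boundary w (pw : paths w) : boundary :=
  exist (fun w => w \in paths) w (mem_set pw).

Fact root_subproof : exists _ : level T 0, true.
Proof.
have /card_gt0P[r _] : (0 < #|level T 0|)%N by rewrite card_level0.
by exists r.
Qed.

Fact child_subproof l (v : level T l) : exists w, adj v w.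
Proof.
have /card_gt0P[w] : (0 < #|[pred w : level T l.+1 | adj v w]|)%N.
  by rewrite card_children (leq_trans _ (tree_index_ge2 T l)).
by rewrite inE; exists w.
Qed.

Fixpoint some_path (l : nat) : level T l :=
  if l is l'.+1 then xchoose (child_subproof (some_path l'))
  else xchoose root_subproof.

Fact some_pathP : paths some_path.
Proof. by move=> l; exact: xchooseP (child_subproof _). Qed.

HB.instance Definition _ :=
  isPointed.Build boundary (to_boundary some_pathP).

Definition vertex_at (w : boundary) (l : nat) : level T l := set_val w l.

Definition cylinder (l : nat) (v : level T l) : set boundary :=
  [set w | vertex_at w l = v].

Definition counting_measure (R : realType) (nu : probability (borel boundary) R)
  := forall l (v : level T l),
    nu (cylinder v) = ((\prod_(i < l) tree_index T i)%N%:R^-1)%:E.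

Record tree_aut := TreeAut {
  aut_map :> forall l, level T l -> level T l;
  aut_bij : forall l, bijective (@aut_map l);
  aut_adj : forall l (v : level T l) (w : level T l.+1),
    adj (aut_map v) (aut_map w) = adj v w
}.

Fact aut_boundary_subproof (a : tree_aut) (w : boundary) :
  paths (fun l => a l (vertex_at w l)).
Proof. by move=> l; rewrite aut_adj; exact: (set_valP w). Qed.

Definition aut_boundary (a : tree_aut) (w : boundary) : boundary :=
  to_boundary (aut_boundary_subproof a w).

Definition locally_nondegenerate (R : realType)
    (nu : probability (borel boundary) R) (a : tree_aut) :=
  exists2 alpha : R, 0 < alpha <= 1 &
    forall l (v : level T l), a l v = v ->
      ~ (forall w, cylinder v w -> aut_boundary a w = w) ->
      (alpha%:E * nu (cylinder v) <=
       nu (cylinder v `&` [set w | aut_boundary a w <> w]))%E.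

End boundary.

(* [nu] ranges over a class with exactly one element, the counting measure of
   the boundary of [T]. *)
Definition locally_nondegenerate_action (R : realType) (G : groupType)
    (X : ptopologicalType) (Phi : G -> X -> X) :=
  exists (T : sph_tree) (phi : X -> boundary T),
    let induced_by g a :=
      forall x, phi (Phi g x) = aut_boundary a (phi x) in
    [/\ homeomorphism phi,
        forall g, exists a, induced_by g a &
        forall nu : probability (borel (boundary T)) R, counting_measure nu ->
          forall a, (exists g, induced_by g a) -> locally_nondegenerate nu a].

(* Main.v *)
Require Import Defs.
From HB Require Import structures.
From mathcomp Require Import all_boot all_order all_algebra.
From mathcomp Require Import all_classical all_reals all_analysis.
From mathcomp Require Import borel_hierarchy.
From mathcomp Require Import lra.

(* Call x generic if every g fixing x fixes a neighbourhood of x.  G is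
   countable, so by Baire the generic points form a dense Gdelta set.  Let U be
   a small open set containing generic points x and y: an element of G_x is the
   identity near x, hence on U by quasi-analyticity, hence fixes y; so
   G_x = G_y.  By minimality every generic orbit meets U, and the stabilizers
   of all generic points are conjugate.
   For the measure statement, minimality makes G transitive on each level of
   the tree, so mu is carried to the counting measure.  The points fixed but not
   locally fixed by a tree automorphism lie in a decreasing intersection of
   clopen sets B_l in which, by local non-degeneracy, the pointwise fixed part
   has proportion at most 1 - alpha; the intersection is pointwise fixed, hence
   null, and no density theorem is needed. *)

Set Implicit Arguments.
Unset Strict Implicit.
Unset Printing Implicit Defensive.

Import Order.TTheory GRing.Theory Num.Theory.
Import numFieldNormedType.Exports.

Local Open Scope classical_set_scope.
Local Open Scope ring_scope.

(** * Countability of finitely generated groups *)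

Section countable_group.
Context {G : groupType}.
Local Open Scope group_scope.

Lemma is_subgroupP (H : set G) :
  is_subgroup H <-> H 1 /\ (forall g h, H g -> H h -> H (g / h)).
Proof.
split=> -[H1 HD]; split.
- by move: H1; rewrite inE.
- by move=> g h Hg Hh; have := HD g h; rewrite !inE; apply.
- by rewrite inE.
- by move=> g h; rewrite !inE; exact: HD.
Qed.

(** The Boolean marks an inverse; indices beyond [s] give 1. Words over this alphabet form a
    countable type. *)
Let letter (s : seq G) (b : bool * nat) : G :=
  if b.1 then (nth 1 s b.2)^-1 else nth 1 s b.2.

Let word (s : seq G) (w : seq (bool * nat)) : G :=
  foldr (fun b g => letter s b * g) 1 w.

Let word_cat s w1 w2 : word s (w1 ++ w2) = word s w1 * word s w2.
Proof. by elim: w1 => [|b w1 IH] /=; rewrite ?mul1g// IH mulgA. Qed.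

Let word_inv s w : (word s w)^-1 = word s (rev [seq (~~ b.1, b.2) | b <- w]).
Proof.
elim: w => [|[b i] w IH] /=; first by rewrite invg1.
rewrite rev_cons -cats1 word_cat -IH invgM /= mulg1 /letter /=.
by case: b => //=; rewrite invgK.
Qed.

Lemma finitely_generated_countable : finitely_generated G ->
  exists e : nat -> G, forall g, exists n, e n = g.
Proof.
move=> [s hs]; exists (fun n => word s (odflt [::] (unpickle n))) => g.
(* The values of words form a subgroup containing the generators, hence all of [G]. *)
have : range (word s) g.
  rewrite (hs (range (word s))) //.
    apply/is_subgroupP; split; first by exists [::].
    move=> _ _ [w1 _ <-] [w2 _ <-].
    by exists (w1 ++ rev [seq (~~ b.1, b.2) | b <- w2]) => //;
      rewrite word_cat word_inv.
  move=> x /= xs; exists [:: (false, index x s)] => //=.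
  by rewrite /letter /= mulg1 nth_index.
by move=> [w _ <-]; exists (pickle w); rewrite pickleK.
Qed.

End countable_group.

(** * Baire category in compact Hausdorff spaces *)

(* The nested open sets W n with closure (W n.+1) inside W n and F n have a
   common cluster point by compactness. *)
Lemma compact_hausdorff_baire (X : topologicalType) (F : (set X)^nat) :
  compact [set: X] -> hausdorff_space X ->
  (forall n, open (F n)) -> (forall n, dense (F n)) -> dense (\bigcap_n F n).
Proof.
move=> cX hX oF dF O O0 oO.
(* The hypotheses on [p.2] sit under the existential so that [choice] gives a total function; [set0]
   is a junk value. *)
have step (p : nat * set X) : exists W : set X, open p.2 -> p.2 !=set0 ->
    [/\ open W, W !=set0 & closure W `<=` p.2 `&` F p.1].
  have [[oW W0]|nW] := pselect (open p.2 /\ p.2 !=set0); last first.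
    by exists set0 => oW W0; case: nW.
  have [x Wx] := dF p.1 _ W0 oW.
  have nx : nbhs x (p.2 `&` F p.1) by apply: open_nbhs_nbhs; split; [exact: openI|].
  have [V Vx cV] := @compact_regular X x setT hX cX filterT _ nx.
  exists V^° => _ _; split; first exact: open_interior.
    by exists x; exact: Vx.
  by apply: subset_trans cV; apply: closure_subset; exact: interior_subset.
have [f hf] := choice step.
pose W := fix W n := if n is n'.+1 then f (n', W n') else O.
have W_open n : open (W n) /\ W n !=set0.
  elim: n => [//|n [oW W0]].
  by have [? ? _] := hf (n, W n) oW W0.
have WS n : closure (W n.+1) `<=` W n `&` F n.
  by have [oW W0] := W_open n; have [_ _] := hf (n, W n) oW W0.
have Wle m n : (m <= n)%N -> W n `<=` W m.
  elim: n => [|n IH]; first by rewrite leqn0 => /eqP ->.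
  rewrite leq_eqVlt => /predU1P[-> //|/IH]; apply: subset_trans.
  by move=> x Wx; have [] := WS n x (subset_closure Wx).
have FF : Filter (filter_from setT W).
  apply: filter_from_filter; first by exists 0%N.
  move=> i j _ _; exists (maxn i j) => // x Wx.
  by split; apply: Wle Wx; rewrite ?leq_maxl ?leq_maxr.
have PF : ProperFilter (filter_from setT W).
  by apply: filter_from_proper => n _; exact: (W_open n).2.
have [p [_]] := cX _ PF filterT.
rewrite clusterE => hp.
have cp n : closure (W n) p by apply: hp; exists n.
exists p; split; first by have [] := WS 0%N p (cp 1%N).
by move=> n _; have [] := WS n p (cp n.+1).
Qed.

(** * Generic points and their stabilizers *)

Section generic_points.
Context {G : groupType} {X : ptopologicalType} (Phi : G -> X -> X).
Hypothesis hPhi : is_action Phi.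

Definition generic_point (x : X) :=
  forall g, Phi g x = x -> \forall y \near x, Phi g y = y.

Lemma action_continuous g : continuous (Phi g).
Proof. by case: hPhi => /(_ g)[]. Qed.

Lemma actK g : cancel (Phi g) (Phi g^-1%g).
Proof. by case: hPhi => _ h1 hM x; rewrite -hM mulVg h1. Qed.

Lemma actKV g : cancel (Phi g^-1%g) (Phi g).
Proof. by case: hPhi => _ h1 hM x; rewrite -hM mulgV h1. Qed.

(** If [g] fixes the image of [x] under [h], its conjugate by [h] fixes [x], hence a neighbourhood
    of [x], which [h] carries back. *)
Lemma generic_point_act h x : generic_point x -> generic_point (Phi h x).
Proof.
case: (hPhi) => _ h1 hM gx g ghx.
have /gx gxn : Phi (h^-1 * (g * h))%g x = x by rewrite !hM ghx actK.
have : \forall y \near Phi h x, Phi (h^-1 * (g * h))%g (Phi h^-1%g y) = Phi h^-1%g y.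
  have nh : nbhs (Phi h^-1%g (Phi h x))
      [set y | Phi (h^-1 * (g * h))%g y = y] by rewrite actK.
  exact: (@action_continuous h^-1%g (Phi h x) _ nh).
by apply: filterS => y; rewrite !hM actKV => /(can_inj (actK _)).
Qed.

Lemma stabilizer_subgroup x : is_subgroup (stabilizer Phi x).
Proof.
apply/is_subgroupP; case: (hPhi) => _ h1 hM; split; first exact: h1.
move=> g h /= gx hx; rewrite /stabilizer /= hM.
by rewrite -[in LHS]hx actK.
Qed.

Lemma stabilizer_act g x :
  conjugate_subgroups (stabilizer Phi (Phi g x)) (stabilizer Phi x).
Proof.
case: (hPhi) => _ h1 hM; exists g; apply/seteqP; split=> h; rewrite /stabilizer /=.
  move=> hx; exists (g * h * g^-1)%g; first by rewrite !hM actK hx.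
  by rewrite /conjg !mulgA mulVg mul1g -mulgA mulVg mulg1.
by move=> [k kx <-]; rewrite /conjg !hM kx actK.
Qed.

Lemma open_fixed_interior g : open [set x | \forall y \near x, Phi g y = y].
Proof. exact: open_interior. Qed.

Lemma open_moved g : hausdorff_space X -> open [set x | Phi g x <> x].
Proof.
move=> hX; rewrite openE => x /= gx.
have := hX; rewrite open_hausdorff => /(_ _ _ (introN eqP gx)).
move=> [[A B]] /= [/set_mem Ax /set_mem Bx] [oA oB AB].
have nA : \forall y \near x, A (Phi g y).
  have nA : nbhs (Phi g x) A by exact: open_nbhs_nbhs.
  exact: (@action_continuous g x _ nA).
have nB : \forall y \near x, B y by exact: open_nbhs_nbhs.
apply: filterS2 nA nB => y Ay By gy.
have : (A `&` B) y by split=> //; rewrite -gy.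
by rewrite (eqP AB).
Qed.

Lemma generic_point_Gdelta_dense : compact [set: X] -> hausdorff_space X ->
  finitely_generated G -> Gdelta generic_point /\ dense generic_point.
Proof.
move=> cX hX /finitely_generated_countable[e he].
(* [F n] is the complement of the topological boundary of the fixed set of [e n]: an open set either
   lies in the fixed set, so in its interior, or meets the moved set. *)
pose F n := [set x | Phi (e n) x <> x] `|`
            [set x | \forall y \near x, Phi (e n) y = y].
have oF n : open (F n).
  by apply: openU; [exact: open_moved|exact: open_fixed_interior].
have dF n : dense (F n).
  move=> O O0 oO.
  have [fixO|] := pselect (O `<=` [set x | Phi (e n) x = x]).
    have [x Ox] := O0; exists x; split=> //; right.
    by apply: filterS fixO _; exact: open_nbhs_nbhs.
  move=> /existsNP[x /not_implyP[Ox fx]].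
  by exists x; split=> //; left.
have gE : generic_point = \bigcap_n F n.
  apply/seteqP; split=> x gx.
    move=> n _; have [fx|] := pselect (Phi (e n) x = x); last by left.
    by right; exact: gx.
  move=> g fx; have [n en] := he g.
  by have [|] := gx n I; rewrite /= en.
by split; [exists F|rewrite gE; exact: compact_hausdorff_baire].
Qed.

Context {R : realType} (D : X -> X -> R).
Hypothesis hD : compatible_metric D.

Lemma metric_ball_open x (r : R) : open [set y | D x y < r].
Proof.
case: hD => _ _ _ tri ->; move=> y /= xy.
exists (r - D x y); first by rewrite subr_gt0.
by move=> z /= yz; rewrite (le_lt_trans (tri _ y _))// -ltrBrDl.
Qed.

Lemma metric_ball_diameter x (r : R) :
  (diameter D [set y | (D x y < r)%R] <= (r + r)%:E)%E.
Proof.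
case: hD => _ _ sym tri _.
apply: ge_ereal_sup => _ [[y z] [/= xy xz] <-]; rewrite lee_fin.
by rewrite (le_trans (tri _ x _))// sym lerD ?ltW.
Qed.

Lemma generic_stabilizer_sub (U : set X) x y :
  (forall V : set X, open V -> V !=set0 -> V `<=` U -> forall g1 g2 : G,
      (forall x, V x -> Phi g1 x = Phi g2 x) ->
      (forall x, U x -> Phi g1 x = Phi g2 x)) ->
  open U -> U x -> U y -> generic_point x ->
  stabilizer Phi x `<=` stabilizer Phi y.
Proof.
case: (hPhi) => _ h1 hM hU oU Ux Uy gx g /gx ngx.
suff : Phi g y = Phi 1%g y by rewrite h1.
(* Quasi-analyticity compares [g] with 1 on the part of [U] where [g] is locally trivial, nonempty
   because it contains [x]. *)
apply: (hU (U `&` [set z | \forall t \near z, Phi g t = t])) => //.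
- by apply: openI => //; exact: open_fixed_interior.
- by exists x.
- by move=> z [_ /nbhs_singleton] /= ->; rewrite h1.
Qed.

Lemma generic_stabilizer_conjugate x y :
  locally_quasi_analytic Phi D -> minimal Phi ->
  generic_point x -> generic_point y ->
  conjugate_subgroups (stabilizer Phi x) (stabilizer Phi y).
Proof.
move=> [e e0 lqa] hmin gx gy.
(* The diameter is at most twice the radius, and 2e/3 is strictly below e. *)
pose U := [set z | D x z < e / 3%:R].
have oU : open U by exact: metric_ball_open.
have Ux : U x.
  by case: hD => _ /(_ x x)[_ Dxx] _ _ _; rewrite /U /= Dxx// divr_gt0.
have dU : (diameter D U < e%:E)%E.
  apply: le_lt_trans (metric_ball_diameter _ _) _.
  by rewrite lte_fin; lra.
have [z [Uz [g _ gyz]]] := hmin y U (ex_intro _ x Ux) oU.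
rewrite -{}gyz in Uz.
suff -> : stabilizer Phi x = stabilizer Phi (Phi g y) by exact: stabilizer_act.
apply/seteqP; split; apply: (generic_stabilizer_sub (lqa U oU dU)) => //.
exact: generic_point_act.
Qed.

End generic_points.

(** * Paths and cylinders in the boundary of a tree *)

Section boundary_theory.
Variable T : sph_tree.
Implicit Types (w : boundary T) (l : nat).

Lemma adj_parent_inj l (u v : level T l) (x : level T l.+1) :
  adj u x -> adj v x -> u = v.
Proof.
move=> ux vx; have [p hp] := mem_card1 (card_parents x).
by transitivity p; [|symmetry]; apply/eqP; rewrite -[_ == _]hp inE.
Qed.

Lemma vertex_at_adj w l : adj (vertex_at w l) (vertex_at w l.+1).
Proof. exact: (set_valP w). Qed.

Lemma vertex_at_le w w' k l : (k <= l)%N ->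
  vertex_at w l = vertex_at w' l -> vertex_at w k = vertex_at w' k.
Proof.
elim: l => [|l IH]; first by rewrite leqn0 => /eqP->.
rewrite leq_eqVlt => /predU1P[-> //|kl] ww'; apply: IH => //.
apply: adj_parent_inj (vertex_at_adj w l) _.
by rewrite ww'; exact: vertex_at_adj.
Qed.

Lemma partial_path l (v : level T l) : exists f : forall j, level T j,
  f l = v /\ forall j, (j < l)%N -> adj (f j) (f j.+1).
Proof.
elim: l v => [|l IH] v.
  (* Only levels up to [l] matter; [some_path] fills in the others. *)
  exists (dfwith (@some_path T) 0%N v); split=> //; exact: dfwithin.
have /card_gt0P[p] : (0 < #|[pred u : level T l | adj u v]|)%N.
  by rewrite card_parents.
rewrite inE => pv; have [f [fl hf]] := IH p.
exists (dfwith f l.+1 v); split; first exact: dfwithin.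
move=> j; rewrite ltnS leq_eqVlt => /predU1P[->|jl].
  by rewrite dfwithin dfwithout ?gtn_eqF// fl.
by rewrite !dfwithout ?gtn_eqF ?ltnS ?hf// ltnW.
Qed.

Lemma path_through l (v : level T l) : exists w, vertex_at w l = v.
Proof.
have [f [<- hf]] := partial_path v.
(* [F] follows [f] while consecutive vertices are adjacent, so at least up to level [l], and
   otherwise descends to a chosen child. *)
pose F := fix F j : level T j := if j is j'.+1 then
   (if adj (F j') (f j'.+1) then f j'.+1 else xchoose (child_subproof (F j')))
  else f 0%N.
have pF : paths F.
  move=> j /=; case: ifPn => // _; exact: xchooseP (child_subproof _).
exists (to_boundary pF).
have Ff j : (j <= l)%N -> F j = f j.
  by elim: j => // j IH jl /=; rewrite IH ?hf// ltnW.
exact: Ff.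
Qed.

(** Double counting of the edges between consecutive levels: one per lower vertex, [tree_index T l]
    per upper vertex. *)
Lemma card_level l : #|level T l| = (\prod_(i < l) tree_index T i)%N.
Proof.
elim: l => [|l IH]; first by rewrite big_ord0 card_level0.
rewrite big_ord_recr /= -IH -sum1_card.
rewrite (eq_bigr (fun u : level T l.+1 => \sum_(v : level T l | adj v u) 1)%N); last first.
  by move=> u _; rewrite -[LHS](card_parents u) -sum1_card; apply: eq_bigl => v.
rewrite (exchange_big_dep xpredT)//= -sum_nat_const.
apply: eq_bigr => v _; rewrite -(card_children v) -sum1_card.
by apply: eq_bigl => u.
Qed.

Lemma vertex_at_continuous l : continuous
  (fun w => vertex_at w l : discrete_topology (level T l)).
Proof.
move=> w; apply: (@continuous_comp _ _ _ (set_val : boundary T -> _)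
  (proj l)); first exact: initial_continuous.
exact: proj_continuous.
Qed.

Lemma cylinder_open l (v : level T l) : open (cylinder v).
Proof.
apply: (@open_comp _ _ (fun w => vertex_at w l : discrete_topology (level T l))
  [set v]); last exact: discrete_open.
by move=> w _; exact: vertex_at_continuous.
Qed.

Lemma level_set_measurable l (P : set (level T l)) :
  measurable ([set w | P (vertex_at w l)] : set (borel (boundary T))).
Proof.
apply: sub_sigma_algebra.
apply: (@open_comp _ _ (fun w => vertex_at w l : discrete_topology (level T l))
  P); last exact: discrete_open.
by move=> w _; exact: vertex_at_continuous.
Qed.

Lemma cylinder_measurable l (v : level T l) :
  measurable (cylinder v : set (borel (boundary T))).
Proof. exact: (level_set_measurable [set v]). Qed.

Lemma level_set_bigcup l (P : set (level T l)) :
  [set w | P (vertex_at w l)] = \bigcup_(v in P) cylinder v.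
Proof.
apply/seteqP; split=> w /=; first by exists (vertex_at w l).
by move=> [v Pv wv]; move: Pv; rewrite -[v]wv.
Qed.

Lemma cylinder_trivIset l (P : set (level T l)) :
  trivIset P (fun v => cylinder v).
Proof. by move=> u v _ _ [w [uw vw]]; exact: etrans (esym uw) vw. Qed.

Lemma boundary_ext w w' :
  (forall l, vertex_at w l = vertex_at w' l) -> w = w'.
Proof. by move=> ww'; apply/val_inj/functional_extensionality_dep. Qed.

Lemma moved_measurable (a : tree_aut T) :
  measurable ([set w | aut_boundary a w <> w] : set (borel (boundary T))).
Proof.
have -> : [set w | aut_boundary a w <> w] =
    \bigcup_l [set w | [set v | a l v <> v] (vertex_at w l)].
  apply/seteqP; split=> w /=; last by move=> [l _ /= + aw]; rewrite -[in RHS]aw.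
  move=> aw; apply: contrapT => hw; apply: aw; apply: boundary_ext => l.
  by apply: contrapT => hl; apply: hw; exists l.
by apply: bigcup_measurable => l _; exact: level_set_measurable.
Qed.

(** * Probability measures on the boundary *)

Section measure.
Context {R : realType} (nu : probability (borel (boundary T)) R).
Local Open Scope ereal_scope.

Lemma measure_level_set l (P : set (level T l)) (A : set (borel (boundary T))) :
  measurable A ->
  nu ([set w | P (vertex_at w l)] `&` A) =
  \sum_(v | v \in P) nu (cylinder v `&` A).
Proof.
move=> mA; rewrite level_set_bigcup setI_bigcupl measure_fin_bigcup//.
- rewrite (fsbigE [seq v <- index_enum (level T l) | v \in P])/=.
  + by rewrite big_filter_cond; apply: eq_bigl => v; rewrite andbb.
  + by rewrite filter_uniq// index_enum_uniq.
  + by move=> v /=; rewrite mem_filter => /andP[/set_mem].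
  + by move=> v /mem_set Pv; rewrite mem_filter Pv mem_index_enum.
- exact: finite_finset.
- exact/trivIset_setIr/cylinder_trivIset.
- by move=> v _; apply: measurableI => //; exact: cylinder_measurable.
Qed.

(* The cylinders of level l along which [a] is nowhere locally trivial form a
   decreasing sequence of sets, in each of which the proportion of moved points
   is at least alpha; the limit set is pointwise fixed, hence null. *)
Lemma nondegenerate_null (a : tree_aut T) : locally_nondegenerate nu a ->
  exists B : set (borel (boundary T)), [/\ measurable B, nu B = 0 &
    forall w, aut_boundary a w = w ->
      (forall l, ~ (forall w', cylinder (vertex_at w l) w' ->
         aut_boundary a w' = w')) -> B w].
Proof.
move=> [alpha /andP[a0 _] hnd].
pose M : set (borel (boundary T)) := [set w | aut_boundary a w <> w].
have mM : measurable M := moved_measurable a.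
pose Q l : set (level T l) := [set v | a l v = v /\
  ~ (forall w, cylinder v w -> aut_boundary a w = w)].
pose B l : set (borel (boundary T)) := [set w | Q l (vertex_at w l)].
have mB l : measurable (B l) := level_set_measurable (Q l).
have mcapB : measurable (\bigcap_l B l) by exact: bigcapT_measurable.
have fixB : \bigcap_l B l `<=` ~` M.
  move=> w Bw; apply; apply: boundary_ext => l.
  by have [] := Bw l I.
have proportion l : alpha%:E * nu (B l) <= nu (B l `&` M).
  rewrite [in leRHS]measure_level_set// -[B l]setIT measure_level_set//.
  rewrite ge0_sume_distrr//; apply: lee_sum => v /set_mem[av hv].
  by rewrite setIT; exact: hnd.
(* The limit set lies in the fixed part of [B l], while the moved part has mass at least alpha times
   that of [B l], hence of the limit set. *)
have gap l : nu (\bigcap_l B l) + alpha%:E * nu (\bigcap_l B l) <= nu (B l).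
  have BlB : \bigcap_l B l `<=` B l by move=> w; exact.
  rewrite [leRHS](measureDI _ (mB l) mM) leeD//.
    apply: le_measure; rewrite ?inE//; first exact: measurableD.
    by move=> w Bw; split; [exact: BlB|exact: fixB].
  apply: le_trans (proportion l); rewrite lee_pmul2l//.
  by apply: le_measure; rewrite ?inE.
have cvgB : nu \o B @ \oo --> nu (\bigcap_l B l).
  apply: nonincreasing_cvg_mu => //; first by rewrite ltey_eq fin_num_measure.
  (* Fixing a vertex fixes its ancestors, and triviality on a cylinder passes to smaller ones. *)
  move=> m n mn; apply/subsetPset => w [aw hw]; split.
    by apply: (@vertex_at_le (aut_boundary a w) w _ _ mn).
  move=> hm; apply: hw => w' ww'; apply: hm.
  exact: vertex_at_le mn ww'.
exists (\bigcap_l B l); split => //.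
  have : nu (\bigcap_l B l) + alpha%:E * nu (\bigcap_l B l) <=
         nu (\bigcap_l B l).
    by apply: (cvge_to_ge cvgB); exact: nearW.
  have : nu (\bigcap_l B l) \is a fin_num by exact: fin_num_measure.
  (* In the limit (1 + alpha) b <= b with b finite and nonnegative, so b = 0. *)
  have : 0 <= nu (\bigcap_l B l) by exact: measure_ge0.
  case: (nu (\bigcap_l B l)) => // b; rewrite -EFinM -EFinD !lee_fin.
  move=> b0 _ hb.
  congr EFin; apply/eqP; rewrite eq_le b0 andbT.
  by rewrite -(pmulr_rle0 _ a0) -(lerD2l b) addr0.
move=> w aw hw l _; split; last exact: hw.
by rewrite -[in RHS]aw.
Qed.

(** The cylinders of one level partition the boundary, so each has mass one over their number. *)
Lemma cylinder_uniform_counting :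
  (forall l (u v : level T l), nu (cylinder u) = nu (cylinder v)) ->
  counting_measure nu.
Proof.
move=> nuE l v.
have : nu [set: boundary T] = 1 by exact: probability_setT.
rewrite (_ : [set: boundary T] =
  [set w | [set: level T l] (vertex_at w l)] `&` setT); last first.
  by apply/seteqP; split.
rewrite measure_level_set// (eq_bigr (fun=> nu (cylinder v))); last first.
  by move=> u _; rewrite setIT.
rewrite (eq_bigl xpredT) => [|u]; last by rewrite in_setT.
have : nu (cylinder v) \is a fin_num.
  by apply: fin_num_measure; exact: cylinder_measurable.
case: (nu (cylinder v)) => // r _.
rewrite sumEFin => -[]; rewrite sumr_const -card_level => h.
congr EFin; have N0 : (#|level T l|%:R != 0 :> R)%R.
  by apply/eqP => N0; move/eqP: h; rewrite -mulr_natr N0 mulr0 eq_sym oner_eq0.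
by apply: (mulIf N0); rewrite mulVf// mulr_natr.
Qed.

End measure.
End boundary_theory.

Lemma continuous_borel_measurable (X Y : ptopologicalType) (f : X -> Y) :
  continuous f -> measurable_fun setT (f : borel X -> borel Y).
Proof.
move=> cf; apply: (@measurability _ _ (borel X) (borel Y) setT f (@open Y)) => // _ [A oA <-].
by rewrite setTI; apply: sub_sigma_algebra; exact: open_comp.
Qed.

(** * Transport of the action and the measure to the tree *)

Section transport.
Context {R : realType} {X : ptopologicalType} {G : groupType}.
Context (Phi : G -> X -> X) (mu : probability (borel X) R).
Context (T : sph_tree) (phi : X -> boundary T).
Hypotheses (hPhi : is_action Phi) (hmin : minimal Phi).
Hypotheses (hmu : invariant_measure Phi mu) (hphi : homeomorphism phi).
Hypothesis induced : forall g, exists a : tree_aut T,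
  forall x, phi (Phi g x) = aut_boundary a (phi x).
Context (nu : probability (borel (boundary T)) R).
Hypothesis nuE : forall A, nu A = mu (phi @^-1` A).

(** By minimality some [g] moves a point over [u] into the cylinder of [v]; its automorphism sends
    [u] to [v], and invariance of [mu] equates the two masses. *)
Lemma pushforward_counting : counting_measure nu.
Proof.
case: hphi => cphi [psi [_ phiK psiK]].
apply: cylinder_uniform_counting => l u v.
have [wu hu] := path_through u; have [wv hv] := path_through v.
have oV : open (phi @^-1` cylinder v).
  by apply: open_comp => [x _|]; [exact: cphi|exact: cylinder_open].
have V0 : phi @^-1` cylinder v !=set0 by exists (psi wv); rewrite /= psiK.
have [x [xV [g _ gx]]] := hmin (psi wu) V0 oV.
have [a ha] := induced g; rewrite -{x}gx /= ha psiK in xV.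
have auv : a l u = v by rewrite -hu.
have mv : measurable (phi @^-1` cylinder v : set (borel X)).
  exact: sub_sigma_algebra.
rewrite !nuE -(hmu g mv); congr (mu _).
apply/seteqP; split=> x /=; rewrite /cylinder /= ha => hx.
  by rewrite -auv -hx.
by apply: (bij_inj (aut_bij a l)); rewrite auv; exact: hx.
Qed.

(** A point fixed but not locally fixed by [e n] has no cylinder around its image on which the
    automorphism is trivial, so it falls in a null set; there are countably many [n]. *)
Lemma nongeneric_negligible :
  finitely_generated G ->
  (forall a, (exists g, forall x, phi (Phi g x) = aut_boundary a (phi x)) ->
    locally_nondegenerate nu a) ->
  mu.-negligible (~` generic_point Phi : set (borel X)).
Proof.
move=> /finitely_generated_countable[e he] hnd.
case: hphi => cphi [psi [_ phiK psiK]].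
pose N n : set (borel X) :=
  [set x | Phi (e n) x = x /\ ~ \forall y \near x, Phi (e n) y = y].
have : mu.-negligible (\bigcup_n N n).
  apply: negligible_bigcup => n; have [a ha] := induced (e n).
  have [B [mB B0 hB]] := nondegenerate_null (hnd a (ex_intro _ _ ha)).
  exists (phi @^-1` B); split.
  - rewrite -[X in measurable X]setTI.
    exact: (continuous_borel_measurable cphi).
  - exact: etrans (esym (nuE B)) B0.
  - move=> x [ex nx]; apply: hB => [|l fixl]; first by rewrite -ha ex.
    apply: nx; have nb : nbhs x (phi @^-1` cylinder (vertex_at (phi x) l)).
      apply: open_nbhs_nbhs; split=> //.
      by apply: open_comp => [y _|]; [exact: cphi|exact: cylinder_open].
    by apply: filterS nb => y /fixl; rewrite -ha => /(can_inj phiK).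
apply: negligibleS => x /existsNP[g /not_implyP[gx ngx]].
by have [n en] := he g; exists n => //; rewrite /N /= en.
Qed.

End transport.

Theorem theorem1p7 (R : realType) (X : ptopologicalType) (G : groupType)
    (Phi : G -> X -> X) (D : X -> X -> R) (mu : probability (borel X) R)
    (hX : cantor_like X) (hG : finitely_generated G)
    (hPhi : is_action Phi)
    (hD : compatible_metric D) (hlqa : locally_quasi_analytic Phi D)
    (hmin : minimal Phi) (heq : equicontinuous_action Phi R)
    (hmu : invariant_measure Phi mu) :
  exists H : set G,
    [/\ is_subgroup H,
        residual [set x | conjugate_subgroups H (stabilizer Phi x)] &
        locally_nondegenerate_action R Phi ->
        {ae mu, forall x, conjugate_subgroups H (stabilizer Phi x)}].
Proof.
case: (hX) => _ cX hausX _.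
have [gG gd] := generic_point_Gdelta_dense hPhi cX hausX hG.
(* Density in the whole space yields a generic base point, whose stabilizer serves as [H]. *)
have [x0 [_ gx0]] := gd setT (ex_intro _ point I) openT.
have conj x : generic_point Phi x ->
    conjugate_subgroups (stabilizer Phi x0) (stabilizer Phi x).
  exact: (generic_stabilizer_conjugate hPhi hD).
exists (stabilizer Phi x0); split; first exact: stabilizer_subgroup.
  by exists (generic_point Phi); split=> // x; exact: conj.
move=> [T [phi [hphi ind hnd]]].
have phiM : phi \in @mfun _ _ (borel X) (borel (boundary T)).
  by apply: mem_set; apply: continuous_borel_measurable; exact: hphi.1.
pose nu : probability (borel (boundary T)) R := distribution mu (mfun_Sub phiM).
have nuE A : nu A = mu (phi @^-1` A) by [].
have cnu : counting_measure nu := pushforward_counting hmin hmu hphi ind nuE.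
have := nongeneric_negligible hphi ind nuE hG (hnd nu cnu).
by apply: negligibleS => x nx gx; apply: nx; exact: conj.
Qed.
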